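(* Let $\mathbb{D}=\mathbb{Z}_6[X]/\langle X^2+X+1\rangle$, where $\mathbb{Z}_6=\mathbb{Z}/6\mathbb{Z}$ and $X$ also denotes its class in the quotient. Then the subgroup of the Lagrange subgroup $\mathcal{L}(\mathbb{D})$ generated by the Riordan arrays $$u:=\bigl(1,\ t/(1-3t)\bigr)\quad\text{and}\quad w:=\bigl(1,\ Xt\bigr)$$ is isomorphic to the alternating group $A_4$. Also, for an arbitrary commutative ring $R$ with identity, there exists no embedding (injective group homomorphism) of $A_4$ into the substitution group $\mathcal{J}(R)$ with coefficients in $R$.
   Context: For a commutative ring $S$ with identity and group of units $S^*$, the Lagrange subgroup $\mathcal{L}(S)$ is the subgroup of the Riordan group over $S$ consisting of all pairs $(1,f(t))$, where $f(t)=\sum_{k\ge1}f_kt^k\in S[[t]]$ with $f_1\in S^*$. The operation is $(1,f(t))(1,h(t))=(1,h(f(t)))$ and the identity is $(1,t)$. The substitution group (of formal power series) $\mathcal{J}(S)$ is the subgroup of $\mathcal{L}(S)$ consisting of those $(1,f(t))$ with $f_1=1$. Here $t/(1-3t)$ means the formal power series $\sum_{k\ge 1}3^{k-1}t^k$. *)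

(* Defs.v *)
From HB Require Import structures.
From mathcomp Require Import all_boot all_order all_fingroup all_solvable.
From mathcomp Require Import all_algebra.
From mathcomp Require Import boolp.

Set Implicit Arguments.
Unset Strict Implicit.
Unset Printing Implicit Defensive.

Import GRing.Theory.
Local Open Scope ring_scope.

(* Commutative rings are taken to be [comPzRingType], so that the zero ring is
   allowed. *)

Record fps (S : Type) := FPS { coef :> nat -> S }.

Lemma fpsP (S : Type) (f g : fps S) : f =1 g -> f = g.
Proof. by case: f g => [f] [g] /= /funext ->. Qed.

HB.instance Definition _ (S : Type) := gen_eqMixin (fps S).
HB.instance Definition _ (S : Type) := gen_choiceMixin (fps S).

Section FpsRing.
Variable S : comPzRingType.
Implicit Types f g h : fps S.

Definition fps_zero : fps S := FPS (fun=> 0).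
Definition fps_opp f : fps S := FPS (fun n => - f n).
Definition fps_add f g : fps S := FPS (fun n => f n + g n).
Definition fps_one : fps S := FPS (fun n => (n == 0%N)%:R).
Definition fps_mul f g : fps S :=
  FPS (fun n => \sum_(i < n.+1) f i * g (n - i)%N).

Fact fps_addA : associative fps_add.
Proof. by move=> f g h; apply: fpsP => n /=; rewrite addrA. Qed.
Fact fps_addC : commutative fps_add.
Proof. by move=> f g; apply: fpsP => n /=; rewrite addrC. Qed.
Fact fps_add0 : left_id fps_zero fps_add.
Proof. by move=> f; apply: fpsP => n /=; rewrite add0r. Qed.
Fact fps_addN : left_inverse fps_zero fps_opp fps_add.
Proof. by move=> f; apply: fpsP => n /=; rewrite addNr. Qed.

HB.instance Definition _ :=
  GRing.isZmodule.Build (fps S) fps_addA fps_addC fps_add0 fps_addN.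

Fact fps_mulC : commutative fps_mul.
Proof.
move=> f g; apply: fpsP => n /=; rewrite (reindex_inj rev_ord_inj) /=.
by apply: eq_bigr => i _; rewrite subSS subKn ?leq_ord // mulrC.
Qed.

Fact fps_mulA : associative fps_mul.
Proof.
move=> f g h; apply: fpsP => n.
rewrite (fps_mulC (fps_mul f g)) /=.
pose F j k := f j * (g (n - j - k)%N * h k).
transitivity (\sum_(j < n.+1) \sum_(k < n.+1 | (k <= n - j)%N) F j k).
  apply: eq_bigr => /= j _.
  have -> : \sum_(i < (n - j).+1) g i * h (n - j - i)%N = fps_mul h g (n - j)%N.
    by rewrite fps_mulC.
  rewrite /= big_distrr /=.
  rewrite (big_ord_narrow_leq (leq_subr _ _)).
  by apply: eq_bigr => k _; rewrite /F /= (mulrC (h k)).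
rewrite (exchange_big_dep predT) //=; apply: eq_bigr => k _.
transitivity (\sum_(j < n.+1 | (j <= n - k)%N) F j k).
  apply: eq_bigl => j; rewrite -ltnS -(ltnS j) -!subSn ?leq_ord //.
  by rewrite -subn_gt0 -(subn_gt0 j) -!subnDA addnC.
rewrite (big_ord_narrow_leq (leq_subr _ _)) big_distrr /=.
by apply: eq_bigr => j _; rewrite /F /= -!subnDA addnC mulrA mulrC.
Qed.

Fact fps_mul1 : left_id fps_one fps_mul.
Proof.
move=> f; apply: fpsP => n /=; rewrite big_ord_recl subn0 /= mul1r.
by rewrite big1 ?addr0 // => i _; rewrite mul0r.
Qed.

Fact fps_mulDl : left_distributive fps_mul +%R.
Proof.
move=> f g h; apply: fpsP => n /=; rewrite -big_split /=.
by apply: eq_bigr => i _; rewrite mulrDl.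
Qed.

HB.instance Definition _ :=
  GRing.Zmodule_isComPzRing.Build (fps S) fps_mulA fps_mulC fps_mul1 fps_mulDl.

Lemma coef_fps0 n : (0 : fps S) n = 0. Proof. by []. Qed.
Lemma coef_fps1 n : (1 : fps S) n = (n == 0%N)%:R. Proof. by []. Qed.
Lemma coef_fpsN f n : (- f) n = - f n. Proof. by []. Qed.
Lemma coef_fpsD f g n : (f + g) n = f n + g n. Proof. by []. Qed.
Lemma coef_fpsM f g n : (f * g) n = \sum_(i < n.+1) f i * g (n - i)%N.
Proof. by []. Qed.

Definition fpsX : fps S := FPS (fun n => (n == 1%N)%:R).

(* The substitution h(f(t)).  When f has no constant term, f ^+ k has order at
    least k, so that only the indices k <= n contribute to the coefficient of
    t ^ n; the definition is meaningful only in that case. *)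
Definition fps_comp h f : fps S :=
  FPS (fun n => \sum_(k < n.+1) h k * (f ^+ k) n).

Lemma fps_exp_lt f k n : f 0%N = 0 -> (n < k)%N -> (f ^+ k) n = 0.
Proof.
move=> f0; elim: k n => [//|k IH] n; rewrite ltnS => nk.
rewrite exprS coef_fpsM big_ord_recl f0 mul0r add0r big1 // => i _.
rewrite IH ?mulr0 //= /bump /= add1n.
by apply: leq_trans nk; rewrite ltn_subrL /= (leq_ltn_trans _ (ltn_ord i)).
Qed.

Lemma fps_exp_diag f n : f 0%N = 0 -> (f ^+ n) n = f 1%N ^+ n.
Proof.
move=> f0; elim: n => [//|n IH]; rewrite !exprS coef_fpsM.
rewrite big_ord_recl f0 mul0r add0r big_ord_recl /= subSS subn0 IH.
rewrite big1 ?addr0 // => i _; rewrite fps_exp_lt ?mulr0 //= /bump /= !add1n.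
by rewrite subSS ltn_subrL /= (leq_ltn_trans _ (ltn_ord i)).
Qed.

Lemma fps_comp_widen h f n N : f 0%N = 0 -> (n < N)%N ->
  fps_comp h f n = \sum_(k < N) h k * (f ^+ k) n.
Proof.
move=> f0 nN /=.
rewrite (big_ord_widen N (fun k => h k * (f ^+ k) n)) //.
rewrite [RHS](bigID (fun k : 'I_N => k < n.+1)%N) /= [X in _ + X]big1 ?addr0 //.
by move=> k; rewrite -leqNgt => nk; rewrite fps_exp_lt ?mulr0.
Qed.

Lemma fps_comp0 h f : f 0%N = 0 -> fps_comp h f 0%N = h 0%N.
Proof. by move=> f0; rewrite /= big_ord1 mulr1. Qed.

Lemma fps_comp_1 h f : f 0%N = 0 -> fps_comp h f 1%N = h 1%N * f 1%N.
Proof.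
by move=> f0; rewrite /= big_ord_recl big_ord1 /= mulr0 add0r.
Qed.

Lemma fps_compX f : f 0%N = 0 -> fps_comp fpsX f = f.
Proof.
move=> f0; apply: fpsP => n; rewrite (@fps_comp_widen _ _ _ n.+2) //.
rewrite 2!big_ord_recl /= mul0r add0r mul1r expr1 big1 ?addr0 // => i _.
by rewrite mul0r.
Qed.

Lemma fps_Xexp k n : (fpsX ^+ k) n = (n == k)%:R.
Proof.
elim: k n => [|k IH] [|n] //; rewrite exprS coef_fpsM.
  by rewrite big_ord1 mul0r.
rewrite 2!big_ord_recl /= mul0r add0r mul1r subSS subn0 IH big1 ?addr0 //.
by move=> i _; rewrite mul0r.
Qed.

Lemma fps_comp_X f : fps_comp f fpsX = f.
Proof.
apply: fpsP => n /=; rewrite big_ord_recr /= fps_Xexp eqxx mulr1.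
rewrite big1 ?add0r // => i _; rewrite fps_Xexp.
by rewrite gtn_eqF ?mulr0 ?ltn_ord.
Qed.

Lemma fps_comp1 f : f 0%N = 0 -> fps_comp 1 f = 1.
Proof.
move=> f0; apply: fpsP => n /=; rewrite /= big_ord_recl /= mul1r.
by rewrite big1 ?addr0 // => i _; rewrite mul0r.
Qed.

Lemma fps_compM g h f : f 0%N = 0 ->
  fps_comp (g * h) f = fps_comp g f * fps_comp h f.
Proof.
move=> f0; apply: fpsP => n.
pose F (i l : nat) := g i * h l * (f ^+ (i + l)) n.
have F0 i l : (n < i + l)%N -> F i l = 0.
  by move=> lt; rewrite /F fps_exp_lt ?mulr0.
transitivity (\sum_(i < n.+1) \sum_(l < n.+1) F i l).
  transitivity (\sum_(k < n.+1) \sum_(i < n.+1 | (i <= k)%N) F i (k - i)%N).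
    apply: eq_bigr => k _; rewrite coef_fpsM mulr_suml.
    rewrite (big_ord_widen n.+1 (fun i => g i * h (k - i)%N * (f ^+ k) n)) //.
    by apply: eq_big => // i; rewrite ltnS => ik; rewrite /F subnKC.
  rewrite (exchange_big_dep predT) //=; apply: eq_bigr => i _.
  rewrite -(big_mkord (fun k => (i <= k)%N) (fun k => F i (k - i)%N)).
  rewrite (big_cat_nat (n := i)) //=; last by rewrite ltnW.
  rewrite big_nat_cond big1 ?add0r; last first.
    by move=> k /andP[/andP[_ ki] ik]; rewrite leqNgt ki in ik.
  rewrite -{1}[val i]add0n big_addn.
  rewrite (eq_bigl xpredT); last by move=> k; rewrite leq_addl.
  rewrite big_mkord (eq_bigr (fun l : 'I__ => F i l)); last first.
    by move=> l _; rewrite addnK.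
  rewrite (big_ord_widen n.+1 (fun l => F i l)) ?leq_subr //.
  rewrite [RHS](bigID (fun l : 'I_n.+1 => (l < n.+1 - i)%N)) /=.
  rewrite [X in _ = _ + X]big1 ?addr0 // => l; rewrite -leqNgt => il.
  by apply: F0; rewrite -leq_subLR.
rewrite coef_fpsM.
transitivity (\sum_(j < n.+1) \sum_(i < n.+1) \sum_(l < n.+1)
   g i * h l * ((f ^+ i) j * (f ^+ l) (n - j)%N)).
  rewrite [RHS]exchange_big /=; apply: eq_bigr => i _.
  rewrite [RHS]exchange_big /=; apply: eq_bigr => l _.
  by rewrite /F exprD coef_fpsM mulr_sumr.
apply: eq_bigr => j _.
rewrite (@fps_comp_widen g f j n.+1) // (@fps_comp_widen h f (n - j) n.+1) //;
  last by rewrite ltnS leq_subr.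
rewrite mulr_suml; apply: eq_bigr => i _; rewrite mulr_sumr.
by apply: eq_bigr => l _; rewrite mulrACA.
Qed.

Lemma fps_compXn g f k : f 0%N = 0 -> fps_comp (g ^+ k) f = fps_comp g f ^+ k.
Proof.
move=> f0; elim: k => [|k IH]; first by rewrite !expr0 fps_comp1.
by rewrite !exprS fps_compM // IH.
Qed.

Lemma fps_compA h g f : f 0%N = 0 -> g 0%N = 0 ->
  fps_comp (fps_comp h g) f = fps_comp h (fps_comp g f).
Proof.
move=> f0 g0; apply: fpsP => n /=.
transitivity (\sum_(k < n.+1) \sum_(i < n.+1) h k * (g ^+ k) i * (f ^+ i) n).
  rewrite [RHS]exchange_big /=; apply: eq_bigr => i _.
  have -> : \sum_(k < i.+1) h k * (g ^+ k) i = fps_comp h g i by [].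
  by rewrite (@fps_comp_widen h g i n.+1) // mulr_suml.
apply: eq_bigr => k _; rewrite -fps_compXn //= mulr_sumr.
by apply: eq_bigr => i _; rewrite mulrA.
Qed.

Lemma fps_left_inverse f (y : S) : f 0%N = 0 -> y * f 1%N = 1 ->
  exists g, [/\ g 0%N = 0, g 1%N * f 1%N = 1 & fps_comp g f = fpsX].
Proof.
move=> f0 yf.
pose step (s : seq S) : S := let n := size s in
  y ^+ n * ((n == 1%N)%:R - \sum_(k < n) s`_k * (f ^+ k) n).
pose L := fix L n := if n is m.+1 then rcons (L m) (step (L m)) else [::].
have sL n : size (L n) = n by elim: n => //= n IH; rewrite size_rcons IH.
pose g := FPS (fun n => step (L n)).
have nthL k n : (k < n)%N -> (L n)`_k = g k.
  elim: n => [//|n IH]; rewrite ltnS leq_eqVlt /= nth_rcons sL.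
  by case/orP => [/eqP <-|kn]; [rewrite ltnn eqxx | rewrite kn IH].
have comp : fps_comp g f = fpsX.
  apply: fpsP => n /=; rewrite big_ord_recr /= fps_exp_diag // /step sL.
  rewrite (eq_bigr (fun k : 'I_n => (L n)`_k * (f ^+ k) n)); last first.
    by move=> k _; rewrite nthL.
  by rewrite mulrAC -exprMn yf expr1n mul1r addrC subrK.
exists g; split=> //; first by rewrite -(fps_comp0 g f0) comp.
by rewrite -fps_comp_1 // comp.
Qed.

End FpsRing.

Section Lagrange.
Variable S : comPzRingType.

Definition lagrange_pred (f : fps S) : bool :=
  `[< f 0%N = 0 /\ exists y, y * f 1%N = 1 >].

(* The Riordan array (1, f(t)) is represented by its second component, the
   first one being constant. *)
Record lagrange_group : predArgType :=
  Lagrange { lser :> fps S; lser_subproof : lagrange_pred lser }.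

HB.instance Definition _ := [isSub for lser].
HB.instance Definition _ := [Choice of lagrange_group by <:].
Implicit Types f g h : lagrange_group.

Lemma lser0 f : f 0%N = 0.
Proof. by case: f => f /= /asboolP[]. Qed.
Lemma lser1 f : exists y, y * f 1%N = 1.
Proof. by case: f => f /= /asboolP[]. Qed.

Fact lagrange_one_subproof : lagrange_pred (fpsX S).
Proof. by apply/asboolP; split=> //; exists 1; rewrite mulr1. Qed.
Definition lagrange_one := Lagrange lagrange_one_subproof.

Fact lagrange_mul_subproof f h : lagrange_pred (fps_comp h f).
Proof.
apply/asboolP; have f0 := lser0 f; split; first by rewrite fps_comp0 ?lser0.
have [[y yf] [z zh]] := (lser1 f, lser1 h).
by exists (y * z); rewrite fps_comp_1 // [h 1%N * _]mulrC mulrACA yf zh mulr1.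
Qed.
(* (1, f)(1, h) = (1, h(f(t))) *)
Definition lagrange_mul f h := Lagrange (lagrange_mul_subproof f h).

Fact lagrange_inv_ex f : exists g, lagrange_mul f g = lagrange_one.
Proof.
have [y yf] := lser1 f; have [g [g0 g1 gf]] := fps_left_inverse (lser0 f) yf.
have Pg : lagrange_pred g.
  by apply/asboolP; split=> //; exists (f 1%N); rewrite mulrC.
by exists (Lagrange Pg); apply: val_inj.
Qed.
Definition lagrange_inv f := projT1 (cid (lagrange_inv_ex f)).

Fact lagrange_mulA : associative lagrange_mul.
Proof. by move=> f g h; apply: val_inj; rewrite /= fps_compA ?lser0. Qed.
Fact lagrange_mul1g : left_id lagrange_one lagrange_mul.
Proof. by move=> f; apply: val_inj; rewrite /= fps_comp_X. Qed.
Fact lagrange_mulg1 : right_id lagrange_one lagrange_mul.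
Proof. by move=> f; apply: val_inj; rewrite /= fps_compX ?lser0. Qed.
Fact lagrange_mulgV : right_inverse lagrange_one lagrange_inv lagrange_mul.
Proof. by move=> f; rewrite /lagrange_inv; case: cid. Qed.
Fact lagrange_mulVg : left_inverse lagrange_one lagrange_inv lagrange_mul.
Proof.
move=> f; rewrite -[LHS]lagrange_mulg1 -(lagrange_mulgV (lagrange_inv f)).
rewrite -lagrange_mulA (lagrange_mulA f) lagrange_mulgV.
by rewrite lagrange_mul1g.
Qed.

HB.instance Definition _ := isGroup.Build lagrange_group
  lagrange_mulA lagrange_mul1g lagrange_mulg1 lagrange_mulVg lagrange_mulgV.

Definition substitution_pred : {pred lagrange_group} :=
  fun f => `[< f 1%N = 1 >].

Fact substitution_pred_closed : group_closed substitution_pred.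
Proof.
split=> [|f g /asboolP f1 /asboolP g1]; first exact/asboolP.
have gV1 : (g^-1)%g 1%N = 1.
  have /(congr1 (fun a : lagrange_group => a 1%N)) := mulgV g.
  rewrite [LHS](fps_comp_1 _ (lser0 g)) g1 mulr1 => ->.
  by [].
apply/asboolP; rewrite [LHS](fps_comp_1 _ (lser0 f)) f1 mulr1.
exact: gV1.
Qed.

Record substitution_group : predArgType := Substitution {
  subst_val :> lagrange_group;
  subst_subproof : substitution_pred subst_val
}.

HB.instance Definition _ := [isSub for subst_val].
HB.instance Definition _ := [Choice of substitution_group by <:].
HB.instance Definition _ :=
  SubChoice_isSubGroup.Build lagrange_group substitution_pred substitution_group
    substitution_pred_closed.

End Lagrange.

Section GeneratedSubgroup.
Variables (G : groupType) (A : {pred G}).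

Definition gensubg_pred : {pred G} :=
  fun x => `[< forall H : {pred G},
                 group_closed H -> {subset A <= H} -> x \in H >].

Fact gensubg_closed : group_closed gensubg_pred.
Proof.
split=> [|x y /asboolP xA /asboolP yA].
  by apply/asboolP => H [].
apply/asboolP => H cH AH; have [_ cF] := cH.
by apply: cF; [apply: xA | apply: yA].
Qed.

Record gensubg : predArgType :=
  GenSubg { gensubg_val :> G; gensubg_subproof : gensubg_pred gensubg_val }.

HB.instance Definition _ := [isSub for gensubg_val].
HB.instance Definition _ := [Choice of gensubg by <:].
HB.instance Definition _ :=
  SubChoice_isSubGroup.Build G gensubg_pred gensubg gensubg_closed.

End GeneratedSubgroup.

Definition isomorphic_groups (G H : groupType) : Prop :=
  exists phi : {multiplicative G -> H}, bijective phi.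

Definition embeds (G H : groupType) : Prop :=
  exists phi : {multiplicative G -> H}, injective phi.

Definition D_modulus : {poly 'Z_6} := 'X^2 + 'X + 1.
Definition D : comNzRingType := {poly %/ D_modulus}.
Definition D_X : D := 'qX.

(* The library's quotient {poly %/ h} is by h only if h is monic of positive
   degree. *)
Lemma size_D_modulus : size D_modulus = 3%N.
Proof.
rewrite /D_modulus -addrA size_polyDl ?size_polyXn //.
by rewrite size_polyDl ?size_polyX ?size_poly1.
Qed.

Lemma D_modulus_monic : D_modulus \is monic.
Proof.
rewrite monicE /D_modulus -addrA lead_coefDl ?lead_coefXn //.
by rewrite size_polyXn size_polyDl ?size_polyX ?size_poly1.
Qed.

Lemma mk_monic_D_modulus : mk_monic D_modulus = D_modulus.
Proof. by rewrite /mk_monic size_D_modulus D_modulus_monic. Qed.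

Lemma D_X_eq : D_X ^+ 2 + D_X + 1 = 0.
Proof.
pose q := in_qpoly D_modulus : {poly 'Z_6} -> {poly %/ D_modulus}.
have -> : D_X ^+ 2 + D_X + 1 = q D_modulus.
  by rewrite /q /D_modulus !rmorphD rmorphXn rmorph1.
apply: val_inj => /=; rewrite mk_monic_D_modulus.
exact: Pdiv.RingMonic.rmodpp D_modulus_monic.
Qed.

Lemma D_X_unit : (- (D_X + 1)) * D_X = 1.
Proof.
apply/eqP; rewrite mulNr mulrDl mul1r -expr2 eq_sym -subr_eq0 opprK addrC.
by rewrite D_X_eq.
Qed.

(* t / (1 - 3t) = sum_(k >= 1) 3^(k-1) t^k *)
Definition u_series : fps D := FPS (fun n => if n is k.+1 then 3 ^+ k else 0).
Fact u_subproof : lagrange_pred u_series.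
Proof. by apply/asboolP; split=> //; exists 1; rewrite mulr1. Qed.
Definition riordan_u : lagrange_group D := Lagrange u_subproof.

Definition w_series : fps D := FPS (fun n => if n == 1%N then D_X else 0).
Fact w_subproof : lagrange_pred w_series.
Proof.
by apply/asboolP; split=> //; exists (- (D_X + 1)); exact: D_X_unit.
Qed.
Definition riordan_w : lagrange_group D := Lagrange w_subproof.

(* Main.v *)
Require Import Defs.
From HB Require Import structures.
From mathcomp Require Import all_boot all_order all_fingroup all_solvable.
From mathcomp Require Import all_algebra.
From mathcomp Require Import boolp ring.

Set Implicit Arguments.
Unset Strict Implicit.
Unset Printing Implicit Defensive.

Import GRing.Theory.
Local Open Scope ring_scope.

(** The group generated by [u] and [w].  Write [mobius s c] for the series
    s t / (1 - c t).  The product of the Lagrange subgroup multiplies these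
    series as the affine maps z |-> s z + c compose, so [u] is the translation
    by 3 and [w] the multiplication by X.  As 6 = 0 and X^2 + X + 1 = 0, both
    preserve the four-element set {0, 3, 3 X, 3 X^2} (the ideal 3 D, a copy of
    the field with four elements), and they act on it as a double transposition
    and a 3-cycle.  The relation [acts g p] says that g is such a series, with s
    a power of X, and induces the inverse of the permutation p; it is compatible
    with products and inverses, and each of g and p determines the other
    ([acts_fun], [acts_inj]).  Since the two permutations generate the
    alternating group ([Alt4_gen]), the relation [acts] is the graph of an
    isomorphism.  The argument works over any commutative ring in which 6 = 0,
    3 <> 0 and x^2 + x + 1 = 0 ([gensubg_isomorphic_Alt4]).

    Substitution groups.  A substitution group is residually nilpotent while
    the alternating group A_4 is not nilpotent.  Concretely, let a, b and ab be
    the involutions of A_4, permuted cyclically by conjugation by a 3-cycle c,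
    and suppose that these three elements of J(R) agree with t below degree n.
    Their coefficients of degree n are unchanged by conjugation, hence are all
    equal; they are also additive under products, so that they vanish.  By
    induction a = 1 ([substitution_group_trivial]). *)

(** * Leading coefficients in the substitution group *)

Section LeadingCoefficients.
Variable R : comPzRingType.

(** Powers from the second one on gain one degree of agreement: when f has no
    constant term, the coefficient of degree n of f ^+ k, for k >= 2, only
    involves coefficients of f of degree less than n. *)
Lemma fps_exp_congr (f g : fps R) n : f 0%N = 0 -> g 0%N = 0 ->
  (forall m, (m < n)%N -> f m = g m) ->
  forall k m, (m <= n)%N -> (f ^+ k.+2) m = (g ^+ k.+2) m.
Proof.
move=> f0 g0 fg k m le_mn.
have lt_exp j l : (l < n)%N -> (f ^+ j) l = (g ^+ j) l.
  elim: j l => [|j IH] l lt_ln; first by rewrite !expr0.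
  rewrite !exprS !coef_fpsM; apply: eq_bigr => i _.
  rewrite fg ?IH //; first exact: leq_ltn_trans (leq_subr _ _) lt_ln.
  by apply: leq_ltn_trans lt_ln; rewrite -ltnS.
rewrite (exprS f) (exprS g) !coef_fpsM !big_ord_recl f0 g0 !mul0r !add0r.
apply: eq_bigr => i _; rewrite /= /bump /= add1n.
have lt_m : (m - i.+1 < m)%N.
  by rewrite ltn_subrL /= (leq_ltn_trans _ (ltn_ord i)).
rewrite lt_exp; last exact: leq_trans lt_m le_mn.
have [lt_in|le_ni] := ltnP i.+1 n; first by rewrite fg.
(* Here i.+1 = m = n, and the other factor is a constant coefficient. *)
have -> : (m - i.+1)%N = 0%N by apply/eqP; rewrite subn_eq0 (leq_trans le_mn).
by rewrite (fps_exp_lt g0) // !mulr0.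
Qed.

(** If one of two series agrees with t below degree n.+2 and the other one has
    linear coefficient 1, then the coefficients of degree n.+2 add up under
    substitution.  Here the outer series is the one close to t; in the next
    lemma, it is the inner one. *)
Lemma fps_comp_lead_outer (h f : fps R) n : f 0%N = 0 -> f 1%N = 1 ->
  (forall m, (m < n.+2)%N -> h m = fpsX R m) ->
  fps_comp h f n.+2 = f n.+2 + h n.+2.
Proof.
move=> f0 f1 hX; have fn : (f ^+ n.+2) n.+2 = 1.
  by rewrite fps_exp_diag // f1 expr1n.
rewrite /= big_ord_recr (_ : (f ^+ ord_max) n.+2 = 1) // mulr1.
congr (_ + _); rewrite 2!big_ord_recl /= !hX //= mul0r add0r mul1r expr1.
by rewrite big1 ?addr0 // => i _; rewrite hX ?mul0r //= /bump /= !add1n !ltnS.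
Qed.

Lemma fps_comp_lead_inner (h f : fps R) n : h 1%N = 1 ->
  (forall m, (m < n.+2)%N -> f m = fpsX R m) ->
  fps_comp h f n.+2 = f n.+2 + h n.+2.
Proof.
move=> h1 fX; have fk k : (f ^+ k.+2) n.+2 = (n == k)%:R.
  by rewrite (fps_exp_congr _ _ fX) ?fps_Xexp // fX.
rewrite /= 2!big_ord_recl /= mulr0 add0r h1 mul1r expr1.
congr (_ + _); rewrite (eq_bigr (fun k : 'I_n.+1 => h k.+2 * (n == k)%:R)).
  rewrite big_ord_recr /= eqxx mulr1 big1 ?add0r // => i _.
  by rewrite gtn_eqF ?mulr0 ?ltn_ord.
by move=> i _; rewrite -fk.
Qed.

(** If conjugation by c sends a to b and b to a b, then a = 1. *)
Lemma substitution_group_trivial (a b c : substitution_group R) :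
  (c * b = a * c)%g -> (c * (a * b) = b * c)%g -> a = 1%g.
Proof.
move=> cb_ac cd_bc; pose d := (a * b)%g.
have c0 (g : substitution_group R) : g 0%N = 0 := lser0 g.
have c1 (g : substitution_group R) : g 1%N = 1.
  by have /asboolP := subst_subproof g.
have valE (g h : substitution_group R) : lser (g * h)%g = fps_comp h g by [].
have agree n m : (m < n)%N ->
  [/\ a m = fpsX R m, b m = fpsX R m & d m = fpsX R m].
  elim: n m => // n IH m; rewrite ltnS leq_eqVlt.
  case/predU1P=> [->|]; last exact: IH.
  case: n IH => [|[|n]] IH; first by rewrite !c0.
    by rewrite !c1.
  have aX l (lt_l : (l < n.+2)%N) : a l = fpsX R l by case: (IH l lt_l).
  have bX l (lt_l : (l < n.+2)%N) : b l = fpsX R l by case: (IH l lt_l).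
  have dX l (lt_l : (l < n.+2)%N) : d l = fpsX R l by case: (IH l lt_l).
  (* c b = a c and c (a b) = b c, where only c has an arbitrary coefficient of
     degree n.+2, which cancels. *)
  have ab : b n.+2 = a n.+2.
    have := congr1 (fun g : substitution_group R => g n.+2) cb_ac.
    rewrite !valE (fps_comp_lead_outer (c0 c) (c1 c) bX).
    by rewrite (fps_comp_lead_inner (c1 c) aX) addrC => /addIr.
  have bd : d n.+2 = b n.+2.
    have := congr1 (fun g : substitution_group R => g n.+2) cd_bc.
    rewrite !valE (fps_comp_lead_outer (c0 c) (c1 c) dX).
    by rewrite (fps_comp_lead_inner (c1 c) bX) addrC => /addIr.
  have dE : d n.+2 = a n.+2 + b n.+2 by rewrite valE fps_comp_lead_outer.
  have b0 : b n.+2 = 0 by apply: (addrI (a n.+2)); rewrite -dE addr0 bd.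
  by rewrite bd -ab b0.
do 2!apply: val_inj; apply: fpsP => n.
by have [-> _ _] := agree n.+1 n (ltnSn n).
Qed.

End LeadingCoefficients.

(** * Permutations of four points *)

Definition i0 : 'I_4 := @Ordinal 4 0 isT.
Definition i1 : 'I_4 := @Ordinal 4 1 isT.
Definition i2 : 'I_4 := @Ordinal 4 2 isT.
Definition i3 : 'I_4 := @Ordinal 4 3 isT.

(** [perm_u] and [perm_v] are double transpositions and [perm_w] is a 3-cycle;
    conjugation by [perm_w] permutes cyclically [perm_u], [perm_v] and their
    product.  [perm_u] and [perm_w] will turn out to be the permutations induced
    by u and by the inverse of w on the points 0, 3, 3 X, 3 X^2, in this
    order. *)
Definition perm_u : 'S_4 := (tperm i0 i1 * tperm i2 i3)%g.
Definition perm_v : 'S_4 := (tperm i0 i3 * tperm i1 i2)%g.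
Definition perm_w : 'S_4 := (tperm i1 i3 * tperm i1 i2)%g.

Lemma perm_uE i : perm_u i = tnth [tuple i1; i0; i3; i2] i.
Proof.
by case: i => [[|[|[|[|]]]] ?] //; rewrite permM !permE; apply: val_inj.
Qed.

Lemma perm_vE i : perm_v i = tnth [tuple i3; i2; i1; i0] i.
Proof.
by case: i => [[|[|[|[|]]]] ?] //; rewrite permM !permE; apply: val_inj.
Qed.

Lemma perm_wE i : perm_w i = tnth [tuple i0; i3; i1; i2] i.
Proof.
by case: i => [[|[|[|[|]]]] ?] //; rewrite permM !permE; apply: val_inj.
Qed.


Lemma perm_u_Alt : perm_u \in ('Alt_('I_4))%g.
Proof. by rewrite Alt_even odd_permM !odd_tperm. Qed.
Lemma perm_v_Alt : perm_v \in ('Alt_('I_4))%g.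
Proof. by rewrite Alt_even odd_permM !odd_tperm. Qed.
Lemma perm_w_Alt : perm_w \in ('Alt_('I_4))%g.
Proof. by rewrite Alt_even odd_permM !odd_tperm. Qed.

(** The subgroup generated by [perm_u] and [perm_w] is transitive and has an
    element of order 3, so that its order is a multiple of 12. *)
Lemma Alt4_gen : ('Alt_('I_4))%g = <<[set perm_u; perm_w]>>%g.
Proof.
pose G := <<[set perm_u; perm_w]>>%G; have sGA : G \subset ('Alt_('I_4))%G.
  by rewrite gen_subG; apply/subsetP => p /set2P[] ->;
    [apply: perm_u_Alt | apply: perm_w_Alt].
have Gu : perm_u \in G by rewrite mem_gen ?set21.
have Gw : perm_w \in G by rewrite mem_gen ?set22.
have dvd3 : (3 %| #|G|)%N.
  suff w3 : #[perm_w]%g = 3%N by have := order_dvdG Gw; rewrite w3.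
  apply: nt_prime_order => //.
    apply/permP => i; rewrite perm1 !expgS expg0 mulg1 2![LHS]permM !perm_wE.
    by case: i => [[|[|[|[|]]]] ?]; rewrite // !(tnth_nth i0); apply: val_inj.
  by apply/eqP => /permP/(_ i1); rewrite perm_wE perm1.
have dvd4 : (4 %| #|G|)%N.
  have := @atrans_dvd _ _ 'P G [set: 'I_4]; rewrite cardsT card_ord; apply.
  apply/imsetP; exists i0; first by rewrite inE.
  apply/setP => i; rewrite inE; apply/esym/orbitP.
  have Guw := groupM Gu Gw; have Guww := groupM Guw Gw.
  case: i => [[|[|[|[|]]]] ?] //.
  - by exists 1%g; rewrite ?group1 //= apermE perm1; apply: val_inj.
  - by exists perm_u => //=; rewrite apermE perm_uE; apply: val_inj.
  - exists (perm_u * perm_w * perm_w)%g => //=; rewrite apermE.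
    by rewrite permM perm_wE permM perm_wE perm_uE; apply: val_inj.
  - exists (perm_u * perm_w)%g => //=; rewrite apermE.
    by rewrite permM perm_wE perm_uE; apply: val_inj.
have cardA : #|('Alt_('I_4))%g| = 12%N.
  have := @card_Alt 'I_4; rewrite card_ord => /(_ isT) A24.
  by apply/eqP; rewrite -(eqn_pmul2l (m := 2)) // A24.
apply/esym/eqP; rewrite -[X in X == _]/(gval G) eqEcard sGA /= cardA.
rewrite dvdn_leq ?cardG_gt0 //.
by rewrite (@Gauss_dvd 4 3) // dvd4.
Qed.

(** * No embedding of the alternating group in a substitution group *)

Lemma not_embeds_Alt4 (R : comPzRingType) :
  ~ embeds (subg_of 'Alt_('I_4)) (substitution_group R).
Proof.
case=> phi phi_inj; pose e := subg 'Alt_('I_4).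
have eM p q : p \in ('Alt_('I_4))%g -> q \in ('Alt_('I_4))%g ->
    (phi (e p) * phi (e q))%g = phi (e (p * q)%g).
  by move=> Ap Aq; rewrite /e subgM // gmulfM.
have Au := perm_u_Alt; have Av := perm_v_Alt; have Aw := perm_w_Alt.
have Auv := groupM Au Av; have Auu := groupM Au Au.
have u1 : phi (e perm_u) = 1%g.
  apply: (@substitution_group_trivial _ _ (phi (e perm_v)) (phi (e perm_w))).
    rewrite !eM //; congr (phi (e _)); apply/permP => i.
    rewrite [LHS]permM [RHS]permM !(perm_uE, perm_vE, perm_wE).
    by case: i => [[|[|[|[|]]]] ?]; rewrite // !(tnth_nth i0).
  rewrite !eM //; congr (phi (e _)); apply/permP => i.
  rewrite 2![LHS]permM [RHS]permM !(perm_uE, perm_vE, perm_wE).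
  by case: i => [[|[|[|[|]]]] ?]; rewrite // !(tnth_nth i0).
(* Only an idempotent element can be sent to 1 by an injective multiplicative
   map. *)
have /phi_inj/(congr1 val) : phi (e (perm_u * perm_u)%g) = phi (e perm_u).
  by rewrite -eM // u1 mulg1.
rewrite !subgK // => /permP/(_ i0).
by rewrite [LHS]permM !perm_uE !(tnth_nth i0).
Qed.

(** * The series s t / (1 - c t) *)

Section Mobius.
Variable S : comPzRingType.
Implicit Types s c : S.

(** The series s t / (1 - c t) = sum_(k >= 0) s c^k t^(k+1). *)
Definition mobius s c : fps S :=
  FPS (fun n => if n is k.+1 then s * c ^+ k else 0).

Lemma mobius_id : mobius 1 0 = fpsX S.
Proof. by apply: fpsP => -[|[|n]] //=; rewrite ?mul1r // exprS mul0r. Qed.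

(** The identity [mobius s c] = s t + c t [mobius s c], multiplied by f. *)
Lemma mobius_mulS s c (f : fps S) n :
  (mobius s c * f) n.+1 = s * f n + c * (mobius s c * f) n.
Proof.
rewrite !coef_fpsM big_ord_recl mul0r add0r big_ord_recl /= expr0 mulr1.
rewrite subSS subn0; congr (_ + _).
rewrite [in RHS]big_ord_recl mul0r add0r mulr_sumr; apply: eq_bigr => i _.
by rewrite /= /bump /= !add1n subSS exprS; ring.
Qed.

Lemma mobius_comp s c s' c' :
  fps_comp (mobius s' c') (mobius s c) = mobius (s * s') (c + s * c').
Proof.
set f := mobius s c; set h := mobius s' c'; have f0 : f 0%N = 0 by [].
have compE n N : (n <= N)%N ->
    fps_comp h f n = \sum_(k < N) s' * c' ^+ k * (f ^+ k.+1) n.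
  move=> le_nN; rewrite (@fps_comp_widen _ h f n N.+1) //.
  by rewrite big_ord_recl mul0r add0r.
(* The recurrence that characterizes the series on the right-hand side. *)
have compS n :
    fps_comp h f n.+1 = s * s' * (n == 0%N)%:R + (c + s * c') * fps_comp h f n.
  transitivity (\sum_(k < n.+1) (s * (s' * c' ^+ k * (f ^+ k) n) +
                                 c * (s' * c' ^+ k * (f ^+ k.+1) n))).
    rewrite (compE n.+1 n.+1) //; apply: eq_bigr => k _.
    by rewrite [f ^+ k.+1]exprS mobius_mulS; ring.
  have := compE n n.+1 (leqnSn n); have := compE n n (leqnn n).
  move: (fps_comp h f n) => g gE gES.
  rewrite big_split -!mulr_sumr -gES big_ord_recl.
  rewrite (eq_bigr (fun k : 'I_n => c' * (s' * c' ^+ k * (f ^+ k.+1) n))).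
    by rewrite -mulr_sumr -gE !expr0 coef_fps1 /=; ring.
  by move=> k _; rewrite /= /bump /= add1n (exprS c'); ring.
apply: fpsP; elim=> [|n IH]; first by rewrite fps_comp0.
rewrite compS {}IH; case: n => [|n] /=; first by rewrite !mulr0 addr0 expr0.
by rewrite exprS; ring.
Qed.

(** * The action on the points 0, 3, 3 x, 3 x^2 *)

Variable x : S.
Hypothesis x_root : x ^+ 2 + x + 1 = 0.
Hypothesis six0 : 6 = 0 :> S.
Hypothesis three_neq0 : 3 <> 0 :> S.

(** The four points, numbered by the indices i in 'I_4. *)
Definition pt (i : 'I_4) : S := tnth [tuple 0; 3; 3 * x; 3 * x ^+ 2] i.

Lemma x_cubed : x ^+ 3 = 1.
Proof.
rewrite -[RHS]add0r -[0 in RHS](mulr0 (x - 1)) -x_root; ring.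
Qed.

Lemma pt_distinct : [/\ 3 * x <> 0, 3 * x ^+ 2 <> 0, 3 <> 3 * x,
  3 <> 3 * x ^+ 2 & 3 * x <> 3 * x ^+ 2].
Proof.
have x3 := x_cubed; have x33 : 3 = 3 * x ^+ 3 :> S by rewrite x3 mulr1.
have n01 : 3 <> 3 * x.
  move=> E; apply: three_neq0.
  (* If 3 = 3 x, then 3 = 3 x^2 as well and 0 = 3 (x^2 + x + 1) = 9 = 3. *)
  have E2 : 3 = 3 * x ^+ 2 by rewrite expr2 mulrA -E.
  have -> : 3 = 3 + 3 * x + 3 * x ^+ 2 - 6 by rewrite -E2 -E; ring.
  by rewrite six0 subr0 -[RHS](mulr0 3) -x_root; ring.
split=> // [E|E|E|E].
- by apply: three_neq0; rewrite x33 exprS mulrA E mul0r.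
- by apply: three_neq0; rewrite x33 exprSr mulrA E mul0r.
- by apply: n01; rewrite [LHS]x33 exprSr mulrA -E.
- by apply: n01; rewrite [LHS]x33 exprSr mulrA -E -mulrA -expr2 -E.
Qed.

Lemma pt_inj : injective pt.
Proof.
have [z1 z2 n01 n02 n12] := pt_distinct; have z0 := three_neq0.
case=> [[|[|[|[|]]]] ?] // [[|[|[|[|]]]] ?] //;
  rewrite /pt !(tnth_nth 0) /= => E;
  first [exact: val_inj | by case: three_neq0 | congruence].
Qed.

(** The class of s modulo the annihilator of 3 determines s when s is a power
    of x. *)
Lemma three_powers_inj j k : 3 * x ^+ j = 3 * x ^+ k -> x ^+ j = x ^+ k.
Proof.
have [z1 z2 n01 n02 n12] := pt_distinct.
rewrite -(expr_mod j x_cubed) -(expr_mod k x_cubed).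
move: (ltn_pmod j (isT : 0 < 3)%N) (ltn_pmod k (isT : 0 < 3)%N).
case: (j %% 3)%N (k %% 3)%N => [|[|[|?]]] // [|[|[|?]]] // _ _;
  rewrite ?expr0 ?expr1 ?mulr1 => E //; congruence.
Qed.

(** [acts g p]: the series g is x^k t / (1 - c t), and the affine map
    z |-> x^k z + c sends [pt (p i)] to [pt i].  It is the inverse of p that the
    affine map induces: the product g h of the Lagrange subgroup is h(g(t)) and
    corresponds to the affine map of h followed by that of g, whereas p * q is p
    followed by q. *)
Definition acts (g : lagrange_group S) (p : 'S_4) : Prop :=
  exists k c, g = mobius (x ^+ k) c :> fps S /\
    forall i, x ^+ k * pt (p i) + c = pt i.

Lemma x_exp_cancel k : x ^+ k * x ^+ (2 * k) = 1.
Proof. by rewrite -exprD -mulSn exprM x_cubed expr1n. Qed.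

Lemma acts1 : acts 1%g 1%g.
Proof.
exists 0%N, 0; rewrite expr0 mobius_id; split=> // i.
by rewrite perm1 mul1r addr0.
Qed.

Lemma actsM g h p q : acts g p -> acts h q -> acts (g * h)%g (p * q)%g.
Proof.
case=> j [c [gE pE]] [k [d [hE qE]]]; exists (j + k)%N, (c + x ^+ j * d).
split=> [|i]; last by rewrite permM -[RHS]pE -[pt (p i)]qE exprD; ring.
have -> : lser (g * h)%g = fps_comp h g by [].
by rewrite gE hE mobius_comp exprD.
Qed.

Lemma actsV g p : acts g p -> acts g^-1%g p^-1%g.
Proof.
case=> k [c [gE pE]]; have xk := x_exp_cancel k.
exists (2 * k)%N, (- x ^+ (2 * k) * c); split=> [|i].
  (* A left inverse M of g for substitution is its inverse in the group. *)
  set M := mobius _ _.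
  have Mg : fps_comp M g = fpsX S.
    by rewrite gE mobius_comp xk mulNr mulrN mulrA xk mul1r subrr mobius_id.
  have gVg : fps_comp g (g^-1)%g = fpsX S.
    by rewrite -[LHS]/(lser (g^-1 * g)%g) mulVg.
  by rewrite -(fps_comp_X M) -gVg -fps_compA ?lser0 // Mg fps_compX ?lser0.
rewrite -[in RHS](permKV p i) permKV -(pE (p^-1%g i)) permKV.
by rewrite mulrDr mulrA [_ * x ^+ k]mulrC xk mul1r mulNr addrK.
Qed.

Lemma acts_fun g p q : acts g p -> acts g q -> p = q.
Proof.
case=> j [c [gE pE]] [k [d [gE' qE]]]; apply/permP => i; apply: pt_inj.
have eq_coef n : mobius (x ^+ j) c n = mobius (x ^+ k) d n by rewrite -gE gE'.
have eq_s : x ^+ j = x ^+ k by have := eq_coef 1%N; rewrite /= !mulr1.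
have cancel_s y z : x ^+ k * y = x ^+ k * z -> y = z.
  move/(congr1 ( *%R (x ^+ (2 * k)))); rewrite !mulrA.
  by rewrite ![_ * x ^+ k]mulrC x_exp_cancel !mul1r.
have eq_c : c = d by apply: cancel_s; have := eq_coef 2%N; rewrite /= eq_s.
by apply: cancel_s; apply: (addIr d); rewrite qE -[RHS]pE eq_s eq_c.
Qed.

Lemma acts_inj g h p : acts g p -> acts h p -> g = h.
Proof.
case=> j [c [gE pE]] [k [d [hE qE]]].
(* The permutation determines c, the image of 0, then 3 x^k + c, the image of
   3. *)
have c_pt (e s : S) : (forall i, s * pt (p i) + e = pt i) -> e = pt (p^-1%g i0).
  by move=> E; rewrite -E permKV [pt i0]/= mulr0 add0r.
have eq_cd : c = d by rewrite (c_pt _ _ pE) (c_pt _ _ qE).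
have /three_powers_inj eq_s : 3 * x ^+ j = 3 * x ^+ k.
  apply: (addIr c); have := pE (p^-1%g i1); have := qE (p^-1%g i1).
  rewrite permKV -[pt i1]/3 -eq_cd => <-.
  by rewrite ![x ^+ _ * 3]mulrC.
by apply: val_inj; rewrite /= gE hE eq_s eq_cd.
Qed.

End Mobius.

(** * Isomorphism with the alternating group *)

(** The graph of an isomorphism. *)
Lemma isomorphic_groups_rel (G H : groupType) (r : G -> H -> Prop) :
  (forall g, exists h, r g h) -> (forall h, exists g, r g h) ->
  (forall g h h', r g h -> r g h' -> h = h') ->
  (forall g g' h, r g h -> r g' h -> g = g') ->
  (forall g h g' h', r g h -> r g' h' -> r (g * g')%g (h * h')%g) ->
  isomorphic_groups G H.
Proof.
move=> /choice[f rf] /choice[f' rf'] r_fun r_inj rM.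
have fM : {morph f : g g' / (g * g')%g >-> (g * g')%g}.
  by move=> g g'; apply: r_fun (rf _) (rM _ _ _ _ (rf g) (rf g')).
pose phi : {multiplicative G -> H} :=
  HB.pack f (isMultiplicative.Build _ _ f fM).
by exists phi; exists f' => [g|h]; [apply: r_inj (rf' _) (rf g) |
  apply: r_fun (rf _) (rf' h)].
Qed.

Lemma gensubg_isomorphic_Alt4 (S : comPzRingType) (x : S)
    (u w : lagrange_group S) :
  x ^+ 2 + x + 1 = 0 -> 6 = 0 :> S -> 3 <> 0 :> S ->
  u = mobius 1 3 :> fps S -> w = mobius x 0 :> fps S ->
  isomorphic_groups (gensubg (pred2 u w)) (subg_of 'Alt_('I_4)).
Proof.
move=> x_root six0 three_neq0 uE wE; pose A := pred2 u w.
pose r (g : gensubg A) (p : subg_of 'Alt_('I_4)) := acts x (val g) (val p).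
have acts_u : acts x u perm_u.
  exists 0%N, 3; rewrite expr0; split=> // i; rewrite mul1r perm_uE.
  apply/eqP; rewrite -subr_eq0; apply/eqP; rewrite /pt.
  case: i => [[|[|[|[|]]]] ?] //; rewrite !(tnth_nth 0) /=.
  - by rewrite -[RHS]six0; ring.
  - by ring.
  - transitivity (3 * (x ^+ 2 + x + 1) - 6 * x); first by ring.
    by rewrite x_root six0; ring.
  - transitivity (6 * (1 + x) - 3 * (x ^+ 2 + x + 1)); first by ring.
    by rewrite x_root six0; ring.
have acts_w : acts x w perm_w.
  exists 1%N, 0; rewrite expr1; split=> // i; rewrite addr0 perm_wE /pt.
  have x3 := x_cubed x_root.
  case: i => [[|[|[|[|]]]] ?] //; rewrite !(tnth_nth 0) /=; try by ring.
  by rewrite mulrCA -exprS x3 mulr1.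
apply: (@isomorphic_groups_rel _ _ r).
(* The elements that act by an even permutation form a subgroup containing u
   and w, hence all of the generated subgroup. *)
- move=> g; pose H : {pred lagrange_group S} :=
    fun g => `[< exists2 p, p \in ('Alt_('I_4))%g & acts x g p >].
  have HE : group_closed H.
    split=> [|f h].
      by apply/asboolP; exists 1%g; [apply: group1 | apply: acts1].
    move=> /asboolP[p Ap fp] /asboolP[q Aq hq]; apply/asboolP.
    exists (p * q^-1)%g; first by rewrite groupM ?groupV.
    by apply: actsM => //; apply: actsV.
  have AH : {subset A <= H}.
    move=> f /orP[]/eqP->; apply/asboolP.
      by exists perm_u => //; apply: perm_u_Alt.
    by exists perm_w => //; apply: perm_w_Alt.
  have /asboolP/(_ H HE AH)/asboolP[p Ap gp] := gensubg_subproof g.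
  by exists (subg 'Alt_('I_4) p); rewrite /r subgK.
(* The permutations related to elements of the generated subgroup form a group
   containing the generators of the alternating group. *)
- move=> p; pose K :=
    [set q | `[< exists2 g, g \in gensubg_pred A & acts x g q >]].
  have [gen1 genB] := gensubg_closed A.
  have genM := group_closedM (gensubg_closed A).
  have K_group : group_set K.
    apply/group_setP; split=> [|q q']; rewrite !inE.
      by apply/asboolP; exists 1%g => //; apply: acts1.
    move=> /asboolP[g Ag gq] /asboolP[h Ah hq]; apply/asboolP.
    by exists (g * h)%g; [apply: genM | apply: actsM].
  have genA f : f \in A -> f \in gensubg_pred A.
    by move=> Af; apply/asboolP => H _; apply.
  have /subsetP/(_ _ (subgP p)) : ('Alt_('I_4))%g \subset Group K_group.
    rewrite Alt4_gen gen_subG.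
    apply/subsetP => q /set2P[] ->; rewrite inE; apply/asboolP.
      by exists u => //; apply: genA; rewrite inE eqxx.
    by exists w => //; apply: genA; rewrite inE eqxx orbT.
  by rewrite inE => /asboolP[g Ag gp]; exists (GenSubg Ag).
- move=> g p q gp gq; apply: val_inj; exact: acts_fun gp gq.
- move=> g h p gp hp; apply: val_inj; exact: acts_inj gp hp.
- move=> g p h q; exact: actsM.
Qed.

Lemma D_natr_eq0 n : (n%:R = 0 :> D) <-> (6 %| n)%N.
Proof.
have Z6_eq0 : (n%:R == 0 :> 'Z_6) = (6 %| n)%N.
  by rewrite /dvdn -(val_Zp_nat (p := 6)).
rewrite -Z6_eq0; split=> [/(congr1 val)|/eqP n0].
  by rewrite /= qpolyC_natr -polyC_natr => /eqP; rewrite polyC_eq0.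
by apply: val_inj; rewrite /= qpolyC_natr -polyC_natr n0.
Qed.

Theorem theorem8 :
  isomorphic_groups (gensubg (pred2 riordan_u riordan_w)) (subg_of 'Alt_('I_4))
  /\ forall R : comPzRingType,
       ~ embeds (subg_of 'Alt_('I_4)) (substitution_group R).
Proof.
split; last exact: not_embeds_Alt4.
apply: (@gensubg_isomorphic_Alt4 D D_X) => //.
- exact: D_X_eq.
- exact/D_natr_eq0.
- by move/D_natr_eq0.
- by apply: fpsP => -[|n] //=; rewrite mul1r.
- by apply: fpsP => -[|[|n]] //=; rewrite ?mulr1 // exprS mul0r mulr0.
Qed.
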